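(* Let $\rho$ be a state and $|\psi\rangle$ a pure state of a finite-dimensional system, let $n\ge 1$ be an integer, and suppose that $$\rho\otimes\big(|0\rangle\langle0|\big)^{\otimes n}\ \succ\ |\psi\rangle\langle\psi|\otimes(\mathbb 1/2)^{\otimes n},$$ where $|0\rangle$ is a pure qubit state and $\mathbb 1/2$ the maximally mixed qubit state (as holds when the erasure of $\rho$ to $|\psi\rangle$ is performed by a unital channel with an $n$-qubit information battery, with work cost $W=k_BT\,n\ln2$ of resetting the battery). Then for every integer $m\ge 1$ $$(n\ln2+m-1)^m\ \ge\ \mathrm{Tr}\big[\rho(-\ln\rho+m-1)^m\big].$$ In terms of cumulants, for $m=1,2,3,4$ these read $$n\ln2\ge S(\rho),$$ $$(n\ln2+1)^2\ge[S(\rho)+1]^2+C(\rho),$$ $$(n\ln2+2)^3\ge[S(\rho)+2]^3+3C(\rho)[S(\rho)+2]+C_3(\rho),$$ $$(n\ln2+3)^4\ge[S(\rho)+3]^4+6C(\rho)[S(\rho)+3]^2+3C(\rho)^2+4C_3(\rho)[S(\rho)+3]+C_4(\rho).$$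
   Context: $S(\rho)=-\mathrm{Tr}(\rho\ln\rho)$, $C(\rho)=C_2(\rho)$, and $C_j(\rho)$ is the $j$-th cumulant of $-\ln\rho$ in the state $\rho$, i.e. the $j$-th cumulant of the random variable taking the value $-\ln\lambda_i$ with probability $\lambda_i$, where $\lambda_i$ are the non-zero eigenvalues of $\rho$ (with multiplicity). Zero eigenvalues contribute $0$ to traces. Majorization: for density matrices $\rho_1,\rho_2$ of the same dimension $d$ with eigenvalues in decreasing order $\lambda_1\ge\dots\ge\lambda_d$ and $\kappa_1\ge\dots\ge\kappa_d$, $\rho_1\succ\rho_2$ means $\sum_{k=1}^m\lambda_k\ge\sum_{k=1}^m\kappa_k$ for all $m=1,\dots,d$. *)

(* Defs.v *)
(* Finite-dimensional quantum states over R[i] with R : realType (MathComp and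
   MathComp-Analysis). *)
From HB Require Import structures.
From mathcomp Require Import all_boot all_order all_algebra.
From mathcomp Require Import sesquilinear spectral.
From mathcomp Require Import complex mxtens.
From mathcomp Require Import all_classical all_reals all_analysis.

Set Implicit Arguments.
Unset Strict Implicit.
Unset Printing Implicit Defensive.

Import Order.TTheory GRing.Theory Num.Theory.
Import numFieldNormedType.Exports.

Local Open Scope ring_scope.
Local Open Scope sesquilinear_scope.
Local Open Scope complex_scope.

(* 0 <= z in R[i] means that z is real and nonnegative. *)
Definition is_state (R : realType) (d : nat) (rho : 'M[R[i]]_d) : Prop :=
  [/\ rho \is hermsymmx,
      forall v : 'cV[R[i]]_d, 0 <= (v ^t* *m rho *m v) 0 0
    & \tr rho = 1].

Definition is_unit_ket (R : realType) (d : nat) (psi : 'cV[R[i]]_d) : Prop :=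
  psi ^t* *m psi = 1%:M.

(* |psi><psi| *)
Definition ketbra (R : realType) (d : nat) (psi : 'cV[R[i]]_d) : 'M[R[i]]_d :=
  psi *m psi ^t*.

(* 1/2 *)
Definition mixed_qubit (R : realType) : 'M[R[i]]_2 := (2^-1)%:M.

(* For Hermitian A, (eigval A i)_i lists the eigenvalues of A with
   multiplicity: they are real, and A = U^-1 diag(eigval A) U with
   U = spectralmx A unitary (orthomx_spectralP).  The next definitions are only
   meaningful for Hermitian A. *)
Definition eigval (R : realType) (d : nat) (A : 'M[R[i]]_d) (i : 'I_d) : R :=
  complex.Re (spectral_diag A 0 i).

Definition decreasing_spectrum (R : realType) (d : nat) (A : 'M[R[i]]_d) :
  seq R := sort >=%R [seq eigval A i | i : 'I_d].

Definition majorizes (R : realType) (d : nat) (A B : 'M[R[i]]_d) : Prop :=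
  forall m : nat, (1 <= m <= d)%N ->
    \sum_(k < m) (decreasing_spectrum B)`_k
      <= \sum_(k < m) (decreasing_spectrum A)`_k.

(* ln A by functional calculus.  As ln 0 = 0 in the library, the kernel of A is
   sent to 0; under traces Tr(A f(ln A)) it has weight 0 anyway. *)
Definition lnmx (R : realType) (d : nat) (A : 'M[R[i]]_d) : 'M[R[i]]_d :=
  invmx (spectralmx A)
    *m diag_mx (\row_i (ln (eigval A i))%:C)
    *m spectralmx A.

(* The trace is real for a state, so taking its real part loses nothing. *)
Definition entropy (R : realType) (d : nat) (rho : 'M[R[i]]_d) : R :=
  complex.Re (- \tr (rho *m lnmx rho)).

(* Cumulant generating function t |-> ln E[exp(t X)] of the random variable X
   equal to - ln lambda_i with probability lambda_i, lambda_i <> 0. *)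
Definition cgf (R : realType) (d : nat) (rho : 'M[R[i]]_d) (t : R) : R :=
  ln (\sum_(i < d | eigval rho i != 0)
        eigval rho i * expR (t * - ln (eigval rho i))).

Definition cumulant (R : realType) (d : nat) (j : nat) (rho : 'M[R[i]]_d) : R :=
  derive1n j (cgf rho) 0.

(* Tr[rho (- ln rho + m - 1)^m] *)
Definition shifted_moment (R : realType) (d : nat) (rho : 'M[R[i]]_d)
    (m : nat) : R[i] :=
  \tr (rho *m (- lnmx rho + (m%:R - 1)%:M) ^+ m).

(* Main.v *)
Require Import Defs.
From HB Require Import structures.
From mathcomp Require Import all_boot all_order all_algebra.
From mathcomp Require Import sesquilinear spectral.
From mathcomp Require Import complex mxtens.
From mathcomp Require Import all_classical all_reals all_analysis.
From mathcomp Require Import ring lra.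

(* The spectrum of |psi><psi| (x) (1/2)^(x)n consists of 2^n copies of 2^-n and
   zeros, so its 2^n largest eigenvalues exhaust the trace.  By majorization the
   same holds for rho (x) |0><0|^(x)n, whose remaining eigenvalues therefore
   vanish: rho has at most 2^n nonzero eigenvalues lambda_i.  The function
   x |-> (ln x + m - 1)^m is concave on x >= 1, so Jensen's inequality bounds its
   mean at x = 1 / lambda_i by its value at x = 2^n; here the tangent line at 2^n
   is used directly.  The cumulant forms come from differentiating
   ln E[exp(t X)]: the tilted moments mu_k (t) = E[X^k exp(t X)] / E[exp(t X)]
   satisfy mu_k' = mu_(k+1) - mu_k mu_1. *)

Set Implicit Arguments.
Unset Strict Implicit.

Import Order.TTheory GRing.Theory Num.Theory.
Import numFieldNormedType.Exports.

Local Open Scope ring_scope.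
Local Open Scope complex_scope.

(** * Jensen bound *)

(** For [c > 0], [c ln (x + c) - x] has slope [c / (x + c) - 1 <= 0] on [x >= 0]. The proof needs no
    calculus: [1 + y <= expR y] at [y = (v - u) / (u + c)], raised to the power [c]. The bound fixes
    the sign of a derivative in the tangent estimate. *)
Lemma exprDn_le_expR (R : realType) (c : nat) (u v : R) :
  0 <= u -> u <= v -> (v + c%:R) ^+ c <= (u + c%:R) ^+ c * expR (v - u).
Proof.
move=> u0 uv; case: c => [|c].
  by rewrite !expr0 mul1r -[leLHS]expR0 ler_expR subr_ge0.
have c0 : 0 < u + c.+1%:R by rewrite ltr_wpDl.
have vE : v + c.+1%:R = (u + c.+1%:R) * (1 + (v - u) / (u + c.+1%:R)).
  by rewrite mulrDr mulr1 mulrCA divff ?gt_eqF// mulr1; ring.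
rewrite vE exprMn ler_pM2l ?exprn_gt0//.
have q0 : 0 <= (v - u) / (u + c.+1%:R) by rewrite divr_ge0 ?subr_ge0 // ltW.
apply: (@le_trans _ _ (expR ((v - u) / (u + c.+1%:R)) ^+ c.+1)).
  by apply: lerXn2r; rewrite ?nnegrE ?addr_ge0 ?expR_ge0 ?expR_ge1Dx.
rewrite -expRM_natl ler_expR mulrA ler_pdivrMr// mulrC ler_wpM2l ?subr_ge0//.
by rewrite lerDr.
Qed.

(* In the variable [x = expR u] this is the tangent line at [expR a] of
   [x |-> (ln x + c) ^+ c.+1], which is concave on [x >= 1]. *)
Lemma exprDn_le_tangent (R : realType) (c : nat) (a u : R) : 0 <= a -> 0 <= u ->
  (u + c%:R) ^+ c.+1
    <= (a + c%:R) ^+ c.+1 + c.+1%:R * (a + c%:R) ^+ c * (expR (u - a) - 1).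
Proof.
move=> a0 u0.
(* Up to an additive constant, [f] is the tangent line minus the power. Its derivative [df] is
   nonpositive on [[0, a]] and nonnegative beyond [a], so over [x >= 0] the minimum is at [a]. *)
pose f x : R := c.+1%:R * (a + c%:R) ^+ c * expR (x - a) - (x + c%:R) ^+ c.+1.
pose df x : R := c.+1%:R * ((a + c%:R) ^+ c * expR (x - a) - (x + c%:R) ^+ c).
have fdf (x : R) : is_derive x 1 f (df x).
  pose g (y : R) := y + c%:R.
  pose h (y : R) := y - a.
  have dD (b : R) : is_derive x 1 (fun y => y + b) (1 : R).
    have := is_deriveD (is_derive_id x (1 : R)) (is_derive_cst b x 1).
    by rewrite addr0.
  have dg : is_derive x 1 g 1 := dD _.
  have dh : is_derive x 1 h 1 := dD _.
  have dE := is_derive1_comp (is_derive_expR (h x)) dh.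
  have dX := is_deriveX c.+1 dg.
  have -> : f = (c.+1%:R * (a + c%:R) ^+ c) \*: (expR \o h) - g ^+ c.+1.
    by apply/funext => y; rewrite /f !fctE.
  apply: is_derive_eq.
  by rewrite /df /GRing.scale /= /h /g; ring.
have cf A : ({within A, continuous f})%classic.
  apply: continuous_subspaceT => x; apply: differentiable_continuous.
  by apply/derivable1_diffP; case: (fdf x).
suff : f a <= f u by rewrite /f subrr expR0; lra.
case: (leP a u) => [au | /ltW ua].
  have [x] := MVT_segment au (fun x _ => fdf x) (cf _).
  rewrite in_itv /= => /andP[ax xu] fE; rewrite -subr_ge0 fE.
  rewrite mulr_ge0 ?subr_ge0// mulr_ge0// subr_ge0.
  exact: exprDn_le_expR.
have [x] := MVT_segment ua (fun x _ => fdf x) (cf _).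
rewrite in_itv /= => /andP[ux xa] fE; rewrite -subr_le0 fE.
rewrite mulr_le0_ge0 ?subr_ge0// mulr_ge0_le0// subr_le0.
(* To the left of [a] the roles swap: the growth bound runs from [x] up to [a], with the exponential
   moved to the other side. *)
rewrite -(opprB a x) expRN ler_pdivrMr ?expR_gt0//.
by apply: exprDn_le_expR => //; apply: le_trans ux.
Qed.

(** The tangent bound at [a = ln N] is averaged with weights [p i]. On the support
    [p i * expR (- ln (p i) - a) = 1 / N], so the correction to the value at [a] is [K] times
    (support size over [N], minus 1), which is at most 0. *)
Lemma shifted_moment_le_support (R : realType) (I : finType) (p : I -> R)
    (c N : nat) :
  (forall i, 0 <= p i) -> \sum_i p i = 1 -> (0 < N)%N ->
  (#|[pred i | p i != 0%R]| <= N)%N ->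
  \sum_i p i * (- ln (p i) + c%:R) ^+ c.+1 <= (ln N%:R + c%:R) ^+ c.+1.
Proof.
move=> p0 p1 N0 pN.
have N1 : 0 < N%:R :> R by rewrite ltr0n.
have a0 : 0 <= ln N%:R :> R by rewrite ln_ge0// ler1n.
set a := ln N%:R in a0 *.
pose K := c.+1%:R * (a + c%:R) ^+ c.
have K0 : 0 <= K by rewrite mulr_ge0// exprn_ge0// addr_ge0.
have le1 i : p i <= 1.
  by rewrite -p1 (bigD1 i)//= lerDl sumr_ge0.
(* Where [p i = 0] both summands vanish whatever the default value of [ln 0]; the factor
   [(p i != 0)%:R] counts the support. *)
apply: (@le_trans _ _ (\sum_i (p i * ((a + c%:R) ^+ c.+1 - K)
                               + K * ((p i != 0)%:R / N%:R)))).
  apply: ler_sum => i _; case: (eqVneq (p i) 0) => [-> | pi0] /=.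
    by rewrite !mul0r mulr0 addr0.
  have pi_gt0 : 0 < p i by rewrite lt0r pi0 p0.
  have u0 : 0 <= - ln (p i) by rewrite oppr_ge0 ln_le0.
  have := ler_wpM2l (p0 i) (exprDn_le_tangent c a0 u0).
  rewrite expRD !expRN /a !lnK ?posrE// -/a -/K => /le_trans; apply.
  by rewrite le_eqVlt; apply/orP; left; apply/eqP; field; rewrite pi0 gt_eqF.
rewrite big_split/= -mulr_suml p1 mul1r -mulr_sumr -mulr_suml -natr_sum.
rewrite -addrA gerDl addrC subr_le0 -[leRHS]mulr1 ler_wpM2l//.
rewrite ler_pdivrMr// mul1r ler_nat (leq_trans _ pN)//.
rewrite -sum1_card [leqRHS]big_mkcond /=; apply: leq_sum => i _.
by rewrite inE; case: eqP.
Qed.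

(** * Cumulants *)

(** The [k]-th derivative of the moment generating function of values [x] with weights [p]. The
    predicate [P] is there to match [cgf], whose sum runs over the nonzero eigenvalues. *)
Definition tilted_sum (R : realType) (I : finType) (P : pred I) (p x : I -> R)
    (k : nat) (t : R) : R :=
  \sum_(i | P i) p i * x i ^+ k * expR (t * x i).

Definition tilted_moment (R : realType) (I : finType) (P : pred I)
    (p x : I -> R) (k : nat) (t : R) : R :=
  tilted_sum P p x k t / tilted_sum P p x 0 t.

Lemma is_derive_tilted_sum (R : realType) (I : finType) (P : pred I)
    (p x : I -> R) (k : nat) (t : R) :
  is_derive t 1 (tilted_sum P p x k) (tilted_sum P p x k.+1 t).
Proof.
have -> : tilted_sum P p x k
    = \sum_(i | P i) (fun t => p i * x i ^+ k * expR (t * x i)).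
  by apply/funext => s; rewrite fct_sumE.
rewrite /tilted_sum; elim/big_ind2 : _ => [|f df g dg fdf gdg|i _].
- exact: is_derive_cst.
- exact: is_deriveD.
- apply: is_derive_eq.
  by rewrite !scaler0 ?addr0 /GRing.scale /= /GRing.scale /= exprS; ring.
Qed.

Lemma is_derive_tilted_moment (R : realType) (I : finType) (P : pred I)
    (p x : I -> R) (k : nat) (t : R) :
  (forall t, 0 < tilted_sum P p x 0 t) ->
  is_derive t 1 (tilted_moment P p x k)
    (tilted_moment P p x k.+1 t - tilted_moment P p x k t * tilted_moment P p x 1 t).
Proof.
move=> Z_gt0.
have dk := is_derive_tilted_sum P p x k t.
have d0 := is_derive_tilted_sum P p x 0 t.
have Zn0 : tilted_sum P p x 0 t != 0 by rewrite gt_eqF.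
have dV := is_deriveV Zn0.
apply: is_derive_eq.
rewrite /tilted_moment /GRing.scale /=.
by field.
Qed.

Lemma derive1_ln_tilted_sum (R : realType) (I : finType) (P : pred I)
    (p x : I -> R) :
  (forall t, 0 < tilted_sum P p x 0 t) ->
  derive1 (@ln R \o tilted_sum P p x 0) = tilted_moment P p x 1.
Proof.
move=> Z_gt0.
apply/funext => t; rewrite derive1E.
have d0 := is_derive_tilted_sum P p x 0 t.
have dl := is_derive1_ln (Z_gt0 t).
have d := is_derive1_comp dl d0.
by rewrite derive_val /tilted_moment mulrC.
Qed.

(** The classical expression of cumulants by raw moments, for the tilted law. It is established at
    every [t], not only at 0, so that it can be differentiated again to reach the next order. *)
Lemma ln_tilted_sum_derive2 (R : realType) (I : finType) (P : pred I)
    (p x : I -> R) :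
  (forall t, 0 < tilted_sum P p x 0 t) ->
  derive1n 2 (@ln R \o tilted_sum P p x 0)
    = (fun t => tilted_moment P p x 2 t - tilted_moment P p x 1 t ^+ 2).
Proof.
move=> Z_gt0.
rewrite derive1nS derive1n1 (derive1_ln_tilted_sum Z_gt0).
apply/funext => t; rewrite derive1E.
have d := is_derive_tilted_moment 1 t Z_gt0.
by rewrite derive_val expr2.
Qed.

Lemma ln_tilted_sum_derive3 (R : realType) (I : finType) (P : pred I)
    (p x : I -> R) :
  (forall t, 0 < tilted_sum P p x 0 t) ->
  derive1n 3 (@ln R \o tilted_sum P p x 0)
    = (fun t => tilted_moment P p x 3 t
                - 3 * tilted_moment P p x 1 t * tilted_moment P p x 2 t
                + 2 * tilted_moment P p x 1 t ^+ 3).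
Proof.
move=> Z_gt0.
rewrite derive1nS (ln_tilted_sum_derive2 Z_gt0).
apply/funext => t; rewrite derive1E.
have d1 := is_derive_tilted_moment 1 t Z_gt0.
have d2 := is_derive_tilted_moment 2 t Z_gt0.
by rewrite derive_val /GRing.scale /=; ring.
Qed.

Lemma ln_tilted_sum_derive4 (R : realType) (I : finType) (P : pred I)
    (p x : I -> R) :
  (forall t, 0 < tilted_sum P p x 0 t) ->
  derive1n 4 (@ln R \o tilted_sum P p x 0)
    = (fun t => tilted_moment P p x 4 t
                - 4 * tilted_moment P p x 1 t * tilted_moment P p x 3 t
                - 3 * tilted_moment P p x 2 t ^+ 2
                + 12 * tilted_moment P p x 1 t ^+ 2 * tilted_moment P p x 2 t
                - 6 * tilted_moment P p x 1 t ^+ 4).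
Proof.
move=> Z_gt0.
rewrite derive1nS (ln_tilted_sum_derive3 Z_gt0).
apply/funext => t; rewrite derive1E.
have d1 := is_derive_tilted_moment 1 t Z_gt0.
have d2 := is_derive_tilted_moment 2 t Z_gt0.
have d3 := is_derive_tilted_moment 3 t Z_gt0.
by rewrite derive_val /GRing.scale /=; ring.
Qed.
(** * Spectra of states *)

Local Open Scope sesquilinear_scope.

(** Upper bound: every row is a multiple of a unit row indexed by the support. Lower bound: the
    square submatrix on the support is diagonal with nonzero entries, hence invertible. *)
Lemma mxrank_diag (F : fieldType) (n : nat) (D : 'rV[F]_n) :
  \rank (diag_mx D) = #|[pred i | D 0 i != 0]|.
Proof.
set S := [pred i | _].
pose e : 'I_#|S| -> 'I_n := @enum_val _ S.
have eS k : D 0 (e k) != 0 by have := enum_valP k; rewrite inE.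
have e_inj : injective e by exact: enum_val_inj.
apply/eqP; rewrite eqn_leq; apply/andP; split.
  suff /mxrankS/leq_trans : (diag_mx D <= rowsub e 1%:M)%MS.
    by apply; rewrite rank_leq_row.
  apply/row_subP => i; rewrite row_diag_mx.
  have [-> | Di] := eqVneq (D 0 i) 0; first by rewrite scale0r sub0mx.
  have iS : i \in S by rewrite inE.
  apply: scalemx_sub; rewrite -row1.
  have <- : e (enum_rank_in iS i) = i by rewrite /e enum_rankK_in.
  by rewrite -row_rowsub row_sub.
have unitM : mxsub e e (diag_mx D) \in unitmx.
  have -> : mxsub e e (diag_mx D) = diag_mx (\row_k D 0 (e k)).
    by apply/matrixP => i j; rewrite !mxE (inj_eq e_inj).
  rewrite unitmxE det_diag unitfE; apply/prodf_neq0 => k _.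
  by rewrite mxE.
rewrite -[leqLHS](mxrank_unit unitM).
have -> : mxsub e e (diag_mx D) = rowsub e (colsub e (diag_mx D)).
  by apply/matrixP => i j; rewrite !mxE.
rewrite (leq_trans (mxrankS (rowsub_sub _ _)))//.
by rewrite -[X in colsub e X]mulmx1 -mulmx_colsub mxrankM_maxl.
Qed.

Lemma conjC_real (R : realType) (x : R) : (x%:C : R[i])^*%R = x%:C.
Proof. by apply: conj_Creal; rewrite complex_real. Qed.

Lemma trmxC_mul (C : numClosedFieldType) (m n p : nat) (A : 'M[C]_(m, n))
  (B : 'M[C]_(n, p)) : (A *m B) ^t* = B ^t* *m A ^t*.
Proof. by rewrite trmx_mul map_mxM. Qed.

Lemma trmxC_tens (C : numClosedFieldType) (m n p q : nat) (A : 'M[C]_(m, n))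
  (B : 'M[C]_(p, q)) : (A *t B) ^t* = A ^t* *t B ^t*.
Proof. by rewrite trmx_tens map_mxT. Qed.

Lemma mxtrace_tens (R : pzRingType) (m n : nat) (A : 'M[R]_m) (B : 'M[R]_n) :
  \tr (A *t B) = \tr A * \tr B.
Proof. by rewrite /mxtrace mulr_sum; apply: eq_bigr => i _; rewrite mxE. Qed.

Lemma tens_scalar (R : pzRingType) (m n : nat) (a b : R) :
  a%:M *t b%:M = (a * b)%:M :> 'M[R]_(m * n).
Proof.
apply/matrixP => i j.
case: (mxtens_indexP i) => i0 i1; case: (mxtens_indexP j) => j0 j1.
rewrite tensmxE !mxE (can_eq (@mxtens_indexK m n)) xpair_eqE.
by case: eqP => _; case: eqP => _; rewrite ?mulr1n ?mulr0n ?mulr0 ?mul0r.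
Qed.

Lemma ntens_scalar (R : pzRingType) (m n : nat) (a : R) :
  ntensmx (a%:M : 'M[R]_m) n = (a ^+ n)%:M.
Proof.
case: n => [|n]; first by rewrite ntensmx0 expr0.
elim: n => [|n IHn]; first by rewrite ntensmx1 expr1.
by rewrite ntensmxSS IHn tens_scalar -exprS.
Qed.

(** A nonzero trace gives a nonzero diagonal entry [B j j], and then [B j j *: A] is a submatrix of
    [A *t B]. This compares supports without diagonalising the tensor product. *)
Lemma mxrank_tens_ge (F : fieldType) (m n : nat) (A : 'M[F]_m) (B : 'M[F]_n) :
  \tr B != 0 -> (\rank A <= \rank (A *t B))%N.
Proof.
move=> trB.
have [j Bj] : exists j, B j j != 0.
  apply/existsP; apply: contraNT trB => /existsPn B0.
  by apply/eqP; apply: big1 => j _; apply/eqP; rewrite -[_ == _]negbK B0.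
pose e (i : 'I_m) := mxtens_index (i, j).
have AE : B j j *: A = mxsub e e (A *t B).
  by apply/matrixP => i k; rewrite !mxE !mxtens_indexK mulrC.
rewrite -(mxrank_scale_nz A Bj) AE -[A *t B]mulmx1 mxsub_mul.
apply: leq_trans (mxrankM_maxl _ _) _.
by rewrite mulmx1; apply: mxrankS; apply: rowsub_sub.
Qed.

Lemma hermsymmxP (C : numClosedFieldType) (n : nat) (A : 'M[C]_n) :
  reflect (A ^t* = A) (A \is hermsymmx).
Proof.
by apply: (iffP (is_hermitianmxP _ _ _)); rewrite expr0 scale1r => /esym.
Qed.

Lemma hermsymmx_spectral (R : realType) (n : nat) (A : 'M[R[i]]_n) :
  A \is hermsymmx ->
  A = (spectralmx A) ^t* *m diag_mx (\row_i (eigval A i)%:C) *m spectralmx A.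
Proof.
move=> Ah; rewrite -invmx_unitary ?spectral_unitarymx//.
have /orthomx_spectralP {1}-> := hermitian_normalmx Ah.
congr (_ *m diag_mx _ *m _); apply/rowP => i; rewrite mxE /eigval.
have /mxOverP/(_ 0 i) := hermitian_spectral_diag_real Ah.
by move=> /complex_realP[x ->].
Qed.

Lemma spectralmxK (C : numClosedFieldType) (n : nat) (A : 'M[C]_n) :
  spectralmx A *m (spectralmx A) ^t* = 1%:M.
Proof. exact/unitarymxP/spectral_unitarymx. Qed.

Lemma spectralmxKC (C : numClosedFieldType) (n : nat) (A : 'M[C]_n) :
  (spectralmx A) ^t* *m spectralmx A = 1%:M.
Proof. exact/mulmx1C/spectralmxK. Qed.

Lemma mxtrace_eigval (R : realType) (n : nat) (A : 'M[R[i]]_n) :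
  A \is hermsymmx -> \tr A = (\sum_i eigval A i)%:C.
Proof.
move=> Ah; rewrite {1}(hermsymmx_spectral Ah) mxtrace_mulC mulmxA.
rewrite spectralmxK mul1mx mxtrace_diag rmorph_sum.
by apply: eq_bigr => i _; rewrite mxE.
Qed.

Lemma mxrank_eigval (R : realType) (n : nat) (A : 'M[R[i]]_n) :
  A \is hermsymmx -> \rank A = #|[pred i | eigval A i != 0]|.
Proof.
move=> Ah; rewrite {1}(hermsymmx_spectral Ah).
rewrite mxrankMfree ?row_free_unit ?spectral_unit//.
rewrite -mxrank_tr trmx_mul mxrankMfree; last first.
  by rewrite row_free_unit unitmx_tr -invmx_unitary ?spectral_unitarymx//
    unitmx_inv spectral_unit.
rewrite mxrank_tr mxrank_diag; apply: eq_card => i; rewrite !inE mxE.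
by rewrite -(inj_eq (@complexI R)).
Qed.

Lemma diag_eigval (R : realType) (n : nat) (A : 'M[R[i]]_n) :
  A \is hermsymmx -> diag_mx (\row_i (eigval A i)%:C)
    = spectralmx A *m A *m (spectralmx A) ^t*.
Proof.
move=> Ah; rewrite {3}(hermsymmx_spectral Ah) !mulmxA spectralmxK mul1mx.
by rewrite -mulmxA spectralmxK mulmx1.
Qed.

(** Conjugating by the unitary [spectralmx A] turns the matrix equation into [x ^+ 2 = q * x] for
    each eigenvalue [x]. *)
Lemma eigval_quadratic (R : realType) (n : nat) (A : 'M[R[i]]_n) (q : R) :
  A \is hermsymmx -> A *m A = q%:C *: A ->
  forall i, eigval A i = 0 \/ eigval A i = q.
Proof.
move=> Ah AA i.
have := congr1 (fun B => spectralmx A *m B *m (spectralmx A) ^t*) AA.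
rewrite /= -scalemxAr -scalemxAl -diag_eigval//.
have -> : spectralmx A *m (A *m A) *m (spectralmx A) ^t*
   = (spectralmx A *m A *m (spectralmx A) ^t*)
       *m (spectralmx A *m A *m (spectralmx A) ^t*).
  rewrite !mulmxA; congr (_ *m _ *m _).
  by rewrite -[RHS]mulmxA spectralmxKC mulmx1.
rewrite -diag_eigval// => /matrixP/(_ i i).
rewrite mulmx_diag !mxE eqxx !mulr1n -!rmorphM => /complexI/eqP.
rewrite -subr_eq0 -mulrBl mulf_eq0 => /orP[]/eqP; last by left.
by move=> /subr0_eq; right.
Qed.

(** An eigenvalue is the quadratic form of [A] at its unit eigenvector, the conjugate transpose of a
    row of [spectralmx A]. *)
Lemma eigval_ge0 (R : realType) (n : nat) (A : 'M[R[i]]_n) :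
  is_state A -> forall i, 0 <= eigval A i.
Proof.
move=> [Ah Apos _] i; have := Apos ((row i (spectralmx A)) ^t*).
rewrite trmxCK -row_mul -ler0c.
have := congr1 (fun B : 'M[R[i]]_n => B i i) (diag_eigval Ah).
rewrite /= !mxE eqxx mulr1n => ->.
by congr (0 <= _); apply: eq_bigr => k _; rewrite !mxE.
Qed.

Lemma eigval_sum1 (R : realType) (n : nat) (A : 'M[R[i]]_n) :
  is_state A -> \sum_i eigval A i = 1.
Proof. by move=> [Ah _ A1]; apply: complexI; rewrite -mxtrace_eigval. Qed.

(** * States as Gram matrices, and their tensor products *)

Lemma is_state_gram (R : realType) (n p : nat) (G : 'M[R[i]]_(n, p)) :
  \tr (G *m G ^t*) = 1 -> is_state (G *m G ^t*).
Proof.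
move=> G1; split => //; first by apply/hermsymmxP; rewrite trmxC_mul trmxCK.
move=> v; rewrite !mulmxA -mulmxA -[v ^t* *m G]trmxCK trmxC_mul trmxCK.
set w := G ^t* *m v.
rewrite mxE sumr_ge0// => i _; rewrite !mxE mulrC; exact: mul_conjC_ge0.
Qed.

Lemma is_state_gramP (R : realType) (n : nat) (A : 'M[R[i]]_n) :
  is_state A -> exists G : 'M[R[i]]_n, A = G *m G ^t*.
Proof.
move=> sA; have [Ah _ _] := sA.
exists ((spectralmx A) ^t* *m diag_mx (\row_i (Num.sqrt (eigval A i))%:C)).
rewrite trmxC_mul trmxCK tr_diag_mx map_diag_mx {1}(hermsymmx_spectral Ah).
rewrite !mulmxA; congr (_ *m _); rewrite -mulmxA mulmx_diag.
congr (_ *m diag_mx _); apply/rowP => i.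
by rewrite !mxE /= conjC_real -rmorphM -expr2 sqr_sqrtr// eigval_ge0.
Qed.

(** Positivity comes from the Gram form: if [A = G *m G ^t*] and [B = H *m H ^t*], then [A *t B] is
    the Gram matrix of [G *t H]. *)
Lemma is_state_tens (R : realType) (m n : nat) (A : 'M[R[i]]_m)
    (B : 'M[R[i]]_n) : is_state A -> is_state B -> is_state (A *t B).
Proof.
move=> sA sB; have [_ _ A1] := sA; have [_ _ B1] := sB.
have trAB : \tr (A *t B) = 1 by rewrite mxtrace_tens A1 B1 mulr1.
have [G AE] := is_state_gramP sA; have [H BE] := is_state_gramP sB.
move: trAB; rewrite AE BE -tensmx_mul -trmxC_tens => trAB.
exact: is_state_gram.
Qed.

Lemma is_state_ntens (R : realType) (n k : nat) (A : 'M[R[i]]_n) :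
  is_state A -> is_state (ntensmx A k).
Proof.
move=> sA; case: k => [|k].
  rewrite ntensmx0; have := @is_state_gram R 1 1 1%:M.
  by rewrite trmx1 map_mx1 mulmx1 mxtrace1; apply.
by elim: k => [|k IHk] //; rewrite ntensmxSS; apply: is_state_tens.
Qed.

Lemma is_state_ketbra (R : realType) (n : nat) (psi : 'cV[R[i]]_n) :
  is_unit_ket psi -> is_state (ketbra psi).
Proof.
by move=> psi1; apply: is_state_gram; rewrite mxtrace_mulC psi1 mxtrace1.
Qed.

Lemma is_state_mixed_qubit (R : realType) : is_state (mixed_qubit R).
Proof.
have gramE : mixed_qubit R = (((Num.sqrt 2^-1)%:C)%:M : 'M[R[i]]_2)
     *m (((Num.sqrt 2^-1)%:C)%:M : 'M[R[i]]_2) ^t*.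
  rewrite tr_scalar_mx map_scalar_mx /= conjC_real -scalar_mxM -rmorphM -expr2.
  by rewrite sqr_sqrtr ?invr_ge0// rmorphV ?unitfE// rmorph_nat.
rewrite gramE; apply: is_state_gram; rewrite -gramE mxtrace_scalar.
by rewrite -[LHS]mulr_natr mulVf// pnatr_eq0.
Qed.

(* This scope shadows the tensor power [^t n]. *)
Local Close Scope sesquilinear_scope.

(** * Majorization *)

(** As the entries are nonnegative, the default value 0 past the end prolongs the decreasing
    sequence, so the indices may be arbitrary. *)
Lemma nth_sorted_ge (R : realDomainType) (s : seq R) (j k : nat) :
  sorted >=%R s -> (forall x, x \in s -> 0 <= x) -> (j <= k)%N ->
  s`_k <= s`_j.
Proof.
move=> s_sorted s_ge0 jk.
case: (ltnP k (size s)) => [ks | sk].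
  apply: (sorted_leq_nth (rev_trans le_trans) (@lexx _ _)) => //.
  by rewrite inE (leq_ltn_trans jk).
rewrite (nth_default _ sk); case: (ltnP j (size s)) => [js | sj].
  exact/s_ge0/mem_nth.
by rewrite nth_default.
Qed.

Lemma sum_take (R : nmodType) (s : seq R) (N : nat) :
  \sum_(k < N) s`_k = \sum_(x <- take N s) x.
Proof.
elim: N s => [|N IHN] [|y s] /=; rewrite ?big_nil ?big_cons.
- by rewrite big_ord0.
- by rewrite big_ord0.
- by rewrite big1// => k _; rewrite nth_nil.
- by rewrite big_ord_recl /= IHN.
Qed.

(** The entry at index [N] is the first one outside the sum. If it is 0, so are all later ones and
    the first [N] carry the total; if it is [q], all earlier ones equal [q] and sum to
    [N%:R * q = 1]. *)
Lemma sum_first_two_valued (R : realFieldType) (s : seq R) (N : nat) (q : R) :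
  sorted >=%R s -> 0 <= q -> (forall x, x \in s -> x = 0 \/ x = q) ->
  \sum_(x <- s) x = 1 -> N%:R * q = 1 -> \sum_(k < N) s`_k = 1.
Proof.
move=> s_sorted q0 s0q s1 Nq.
have s_ge0 x : x \in s -> 0 <= x by move=> /s0q[] ->.
have nthE k : s`_k = 0 \/ s`_k = q.
  case: (ltnP k (size s)) => [ks | sk]; first exact/s0q/mem_nth.
  by left; rewrite nth_default.
have [sN | sN] := nthE N.
  rewrite sum_take -[RHS]s1 -[in RHS](cat_take_drop N s) big_cat/=.
  rewrite [X in _ = _ + X]big1_seq ?addr0// => x /andP[_ /(nthP 0)[k _ <-]].
  rewrite nth_drop; apply: le_anti; rewrite -[leRHS]sN.
  rewrite nth_sorted_ge ?leq_addr//=.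
  by have [->|->] := nthE (N + k)%N.
rewrite -Nq -[N in RHS]card_ord -sum1_card natr_sum mulr_suml.
apply: eq_bigr => k _; rewrite mul1r.
have := nth_sorted_ge s_sorted s_ge0 (ltnW (ltn_ord k)).
have [->|-> //] := nthE k.
by rewrite sN => q_le0; apply: le_anti; rewrite q0 q_le0.
Qed.

(** The entries after the first [N] are nonnegative with sum at most 0, so each of them is 0. *)
Lemma count_support_le (R : realDomainType) (s : seq R) (N : nat) :
  (forall x, x \in s -> 0 <= x) ->
  \sum_(x <- s) x <= \sum_(k < N) s`_k -> (count (fun x => x != 0%R) s <= N)%N.
Proof.
move=> s_ge0; rewrite sum_take -{1}(cat_take_drop N s) big_cat/= gerDl => le0.
have drop_ge0 x : x \in drop N s -> 0 <= x by move=> /mem_drop/s_ge0.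
have drop0 : \sum_(x <- drop N s) x = 0.
  by apply: le_anti; rewrite le0 big_seq sumr_ge0.
rewrite -(cat_take_drop N s) count_cat [X in (_ + X)%N]( _ : _ = 0%N).
  rewrite addn0 (leq_trans (count_size _ _))// size_take_min geq_minl //.
apply/eqP; rewrite -leqn0 leqNgt -has_count; apply/hasPn => x xs.
rewrite negbK; move: drop0; rewrite big_seq_cond => /eqP.
rewrite psumr_eq0; last by move=> y; rewrite andbT; exact: drop_ge0.
by move=> /allP/(_ x xs); rewrite xs.
Qed.

Lemma decreasing_spectrum_perm (R : realType) (d : nat) (A : 'M[R[i]]_d) :
  perm_eq (decreasing_spectrum A) [seq eigval A i | i : 'I_d].
Proof. by rewrite perm_sort. Qed.

Lemma decreasing_spectrum_sorted (R : realType) (d : nat) (A : 'M[R[i]]_d) :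
  sorted >=%R (decreasing_spectrum A).
Proof. by apply: sort_sorted => x y; rewrite le_total. Qed.

Lemma mem_decreasing_spectrum (R : realType) (d : nat) (A : 'M[R[i]]_d) x :
  x \in decreasing_spectrum A -> exists i, x = eigval A i.
Proof. by rewrite mem_sort => /mapP[i _ ->]; exists i. Qed.

Lemma sum_decreasing_spectrum (R : realType) (d : nat) (A : 'M[R[i]]_d) :
  \sum_(x <- decreasing_spectrum A) x = \sum_i eigval A i.
Proof.
by rewrite (perm_big _ (decreasing_spectrum_perm _))/= big_map enumT.
Qed.

Lemma count_decreasing_spectrum (R : realType) (d : nat) (A : 'M[R[i]]_d)
  (P : pred R) :
  count P (decreasing_spectrum A) = #|[pred i | P (eigval A i)]|.
Proof.
rewrite (permP (decreasing_spectrum_perm _)) count_map cardE size_filter.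
by rewrite enumT.
Qed.

Lemma tensmxZ (R : comPzRingType) (m n p q : nat) (A : 'M[R]_(m, n))
    (B : 'M[R]_(p, q)) (c : R) : A *t (c *: B) = c *: (A *t B).
Proof. by apply/matrixP => i j; rewrite !mxE mulrCA. Qed.

Lemma support_le_of_majorizes (R : realType) (d n : nat)
    (rho : 'M[R[i]]_d) (psi : 'cV[R[i]]_d) (ket0 : 'cV[R[i]]_2) :
  is_state rho -> is_unit_ket psi -> is_unit_ket ket0 ->
  majorizes (rho *t (ketbra ket0 ^t n)) (ketbra psi *t (mixed_qubit R ^t n)) ->
  (#|[pred i | eigval rho i != 0%R]| <= 2 ^ n)%N.
Proof.
move=> srho upsi uket; set A := rho *t _; set B := ketbra psi *t _ => AB.
(* Trace 1 excludes dimension 0. This makes [2 ^ n] at most the dimension [d * 2 ^ n], hence an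
   index at which majorization applies. *)
have d0 : (0 < d)%N.
  case: d rho psi {A B AB} srho upsi => // rho psi [_ _].
  by rewrite /mxtrace big_ord0 => /eqP; rewrite eq_sym oner_eq0.
have sP := is_state_ntens n (is_state_ketbra uket).
have sA : is_state A := is_state_tens srho sP.
have sB : is_state B := is_state_tens (is_state_ketbra upsi)
  (is_state_ntens n (is_state_mixed_qubit R)).
have [rho_h _ _] := srho; have [A_h _ _] := sA; have [B_h _ _] := sB.
have [_ _ P1] := sP.
(* [B] is [2^-n] times a projection, so its eigenvalues can only be 0 and [2^-n]. *)
have BB : B *m B = (2^-1 ^+ n)%:C *: B.
  rewrite /B tensmx_mul /ketbra mulmxA -[X in X *m _]mulmxA upsi mulmx1.
  rewrite /mixed_qubit ntens_scalar -scalar_mxM -scale_scalar_mx tensmxZ.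
  by rewrite (_ : (2^-1 ^+ n)%:C = 2^-1 ^+ n)// rmorphXn rmorphV ?unitfE// rmorph_nat.
have Bsum : \sum_(k < 2 ^ n) (decreasing_spectrum B)`_k = 1.
  apply: ((sum_first_two_valued (q := 2^-1 ^+ n))).
  - exact: decreasing_spectrum_sorted.
  - by rewrite exprn_ge0// invr_ge0.
  - move=> x /mem_decreasing_spectrum[i ->]; exact: eigval_quadratic.
  - by rewrite sum_decreasing_spectrum eigval_sum1.
  - by rewrite natrX -exprMn divff// expr1n.
(* Ranks carry the support bound from [A] back to [rho]; the battery factor has trace 1, hence
   nonzero. *)
have rank_le : (\rank rho <= \rank A)%N.
  by apply: mxrank_tens_ge; rewrite P1 oner_eq0.
rewrite -mxrank_eigval//; apply: leq_trans rank_le _.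
rewrite mxrank_eigval// -(count_decreasing_spectrum _ (fun x => x != 0)).
apply: count_support_le.
  by move=> x /mem_decreasing_spectrum[i ->]; exact: eigval_ge0.
rewrite sum_decreasing_spectrum eigval_sum1// -Bsum; apply: AB.
by rewrite expn_gt0/= leq_pmull.
Qed.

(** * Shifted moments, entropy and cumulants in terms of eigenvalues *)

Lemma shifted_moment_eigval (R : realType) (d m : nat) (rho : 'M[R[i]]_d) :
  rho \is hermsymmx ->
  shifted_moment rho m
    = (\sum_i eigval rho i * (- ln (eigval rho i) + m%:R - 1) ^+ m)%:C.
Proof.
move=> rho_h; rewrite /shifted_moment.
set U := spectralmx rho.
have Uu : U \in unitmx by exact: spectral_unit.
have logE : - lnmx rho + (m%:R - 1)%:M
    = invmx U *m diag_mx (\row_i (- ln (eigval rho i) + m%:R - 1)%:C) *m U.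
  have -> : (m%:R - 1)%:M = invmx U *m (m%:R - 1)%:M *m U :> 'M[R[i]]_d.
    by rewrite -mulmxA -scalar_mxC mulmxA mulVmx// mul1mx.
  rewrite /lnmx -/U -mulNmx -mulmxN -mulmxDl -mulmxDr; congr (_ *m _ *m _).
  apply/matrixP => i j; rewrite !mxE; case: eqP => _;
    rewrite ?mulr0n ?mulr1n ?oppr0 ?addr0//.
  by rewrite rmorphB rmorphD rmorphN rmorph_nat rmorph1 addrA.
(* The exponent [k] is separated from the shift [m], so that the induction keeps the shift fixed. *)
have powE k : (- lnmx rho + (m%:R - 1)%:M) ^+ k
    = invmx U *m diag_mx (\row_i ((- ln (eigval rho i) + m%:R - 1) ^+ k)%:C) *m U.
  elim: k => [|k IHk].
    rewrite expr0 (_ : diag_mx _ = 1%:M) ?mulmx1 ?mulVmx//.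
    by apply/matrixP => i j; rewrite !mxE expr0.
  rewrite exprS IHk logE -mulmxE !mulmxA mulmxK//; congr (_ *m _).
  rewrite -mulmxA mulmx_diag; congr (_ *m diag_mx _); apply/rowP => i.
  by rewrite !mxE exprS rmorphM.
rewrite powE {1}(hermsymmx_spectral rho_h) -/U.
rewrite -invmx_unitary ?spectral_unitarymx// -/U !mulmxA mulmxK//.
rewrite mxtrace_mulC !mulmxA mulmxV// mul1mx mulmx_diag mxtrace_diag rmorph_sum.
by apply: eq_bigr => i _; rewrite !mxE rmorphM.
Qed.

(** The raw moments of [- ln rho]. The weight [eigval rho i] removes zero eigenvalues for every [k],
    including [k = 0]. *)
Definition surprisal_moment (R : realType) (d : nat) (rho : 'M[R[i]]_d)
    (k : nat) : R :=
  \sum_i eigval rho i * (- ln (eigval rho i)) ^+ k.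

Lemma entropyE (R : realType) (d : nat) (rho : 'M[R[i]]_d) :
  rho \is hermsymmx -> entropy rho = surprisal_moment rho 1.
Proof.
move=> rho_h; have := shifted_moment_eigval 1 rho_h.
rewrite /shifted_moment subrr raddf0 addr0 expr1 mulmxN raddfN.
rewrite /entropy => -> /=; apply: eq_bigr => i _.
by rewrite addrK expr1.
Qed.

Lemma tilted_sum_eigval0 (R : realType) (d : nat) (rho : 'M[R[i]]_d) (k : nat) :
  tilted_sum [pred i | eigval rho i != 0] (eigval rho)
    (fun i => - ln (eigval rho i)) k 0 = surprisal_moment rho k.
Proof.
rewrite /tilted_sum big_mkcond; apply: eq_bigr => i _ /=.
by case: (eqVneq (eigval rho i) 0) => [->|_] /=; rewrite mul0r ?expR0 ?mulr1.
Qed.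

Lemma cumulants_eigval (R : realType) (d : nat) (rho : 'M[R[i]]_d) :
  is_state rho ->
  let M := surprisal_moment rho in
  [/\ cumulant 2 rho = M 2%N - M 1%N ^+ 2,
      cumulant 3 rho = M 3%N - 3 * M 1%N * M 2%N + 2 * M 1%N ^+ 3
    & cumulant 4 rho = M 4%N - 4 * M 1%N * M 3%N - 3 * M 2%N ^+ 2
                       + 12 * M 1%N ^+ 2 * M 2%N - 6 * M 1%N ^+ 4].
Proof.
move=> srho M.
pose P := [pred i | eigval rho i != 0].
pose x i := - ln (eigval rho i).
(* The eigenvalues are nonnegative with sum 1, so at least one is positive and contributes a
   positive term. *)
have Z_gt0 t : 0 < tilted_sum P (eigval rho) x 0 t.
  have term_ge0 i : 0 <= eigval rho i * x i ^+ 0 * expR (t * x i).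
    by rewrite expr0 mulr1 mulr_ge0 ?expR_ge0 ?eigval_ge0.
  have [i rho_i] : exists i, eigval rho i != 0.
    apply/existsP; apply: contraT => /existsPn rho0.
    have := eigval_sum1 srho; rewrite big1 => [/esym/eqP|i _].
      by rewrite oner_eq0.
    by apply/eqP; rewrite -[_ == _]negbK rho0.
  rewrite /tilted_sum (bigD1 i)//= ltr_wpDr ?sumr_ge0//.
  by rewrite expr0 mulr1 mulr_gt0 ?expR_gt0// lt0r rho_i eigval_ge0.
have cgfE : cgf rho = @ln R \o tilted_sum P (eigval rho) x 0.
  apply/funext => t /=; congr ln; apply: eq_bigr => i _.
  by rewrite expr0 mulr1.
(* At [t = 0] the tilt disappears and the normalisation is the trace, equal to 1. *)
have muE k : tilted_moment P (eigval rho) x k 0 = M k.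
  rewrite /tilted_moment !tilted_sum_eigval0 -[RHS]divr1; congr (_ / _).
  rewrite -[RHS](eigval_sum1 srho).
  by apply: eq_bigr => i _; rewrite expr0 mulr1.
by split; rewrite /cumulant cgfE 
  (ln_tilted_sum_derive2 Z_gt0, ln_tilted_sum_derive3 Z_gt0,
    ln_tilted_sum_derive4 Z_gt0)// !muE.
Qed.

(** Binomial theorem on each eigenvalue. Order [m.+1] is used because its shift is then the natural
    number [m]. *)
Lemma shifted_moment_expand (R : realType) (d m : nat) (rho : 'M[R[i]]_d) :
  rho \is hermsymmx ->
  shifted_moment rho m.+1
    = (\sum_(k < m.+2) surprisal_moment rho k * m%:R ^+ (m.+1 - k)
         *+ 'C(m.+1, k))%:C.
Proof.
move=> rho_h; rewrite shifted_moment_eigval//; congr (_%:C).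
under eq_bigr => i _.
  rewrite -addrA -natr1 addrK addrC exprDn mulr_sumr; over.
rewrite exchange_big /=; apply: eq_bigr => k _.
rewrite mulr_suml -sumrMnl; apply: eq_bigr => i _.
by rewrite mulrnAr mulrA mulrAC.
Qed.

Unset Implicit Arguments.

Theorem mainTheorem12 (R : realType) (d n : nat)
    (rho : 'M[R[i]]_d) (psi : 'cV[R[i]]_d) (ket0 : 'cV[R[i]]_2) :
  is_state rho -> is_unit_ket psi -> is_unit_ket ket0 -> (1 <= n)%N ->
  majorizes (rho *t (ketbra ket0 ^t n)) (ketbra psi *t (mixed_qubit R ^t n)) ->
  let S := entropy rho in
  let C := cumulant 2 rho in
  let C3 := cumulant 3 rho in
  let C4 := cumulant 4 rho in
  let w : R := n%:R * ln 2 in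
  [/\ forall m : nat, (1 <= m)%N ->
        shifted_moment rho m <= ((w + m%:R - 1) ^+ m)%:C,
      [/\ shifted_moment rho 1 = S%:C,
          shifted_moment rho 2 = ((S + 1) ^+ 2 + C)%:C,
          shifted_moment rho 3 = ((S + 2) ^+ 3 + 3 * C * (S + 2) + C3)%:C
        & shifted_moment rho 4 =
            ((S + 3) ^+ 4 + 6 * C * (S + 3) ^+ 2 + 3 * C ^+ 2
             + 4 * C3 * (S + 3) + C4)%:C]
    & [/\ S <= w,
          (S + 1) ^+ 2 + C <= (w + 1) ^+ 2,
          (S + 2) ^+ 3 + 3 * C * (S + 2) + C3 <= (w + 2) ^+ 3
        & (S + 3) ^+ 4 + 6 * C * (S + 3) ^+ 2 + 3 * C ^+ 2
             + 4 * C3 * (S + 3) + C4 <= (w + 3) ^+ 4]].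
Proof.
move=> srho upsi uket _ maj S C C3 C4 w.
have [rho_h _ _] := srho.
have bound m : (1 <= m)%N -> shifted_moment rho m <= ((w + m%:R - 1) ^+ m)%:C.
  case: m => // m _; rewrite shifted_moment_eigval// lecR.
  (* The battery work [w] is the logarithm of the support bound [2 ^ n]. *)
  have wE : ln (2 ^ n)%:R = w by rewrite natrX lnXn// /w mulr_natl.
  have -> : w + m.+1%:R - 1 = w + m%:R by rewrite -natr1; ring.
  rewrite -wE; under eq_bigr do rewrite -addrA -[m.+1%:R]natr1 addrK.
  apply: shifted_moment_le_support.
  - exact: eigval_ge0.
  - exact: eigval_sum1.
  - by rewrite expn_gt0.
  - exact: support_le_of_majorizes maj.
have [CE C3E C4E] := cumulants_eigval srho.
have M0 : surprisal_moment rho 0 = 1.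
  rewrite -[RHS](eigval_sum1 srho).
  by apply: eq_bigr => i _; rewrite expr0 mulr1.
have moments : [/\ shifted_moment rho 1 = S%:C,
          shifted_moment rho 2 = ((S + 1) ^+ 2 + C)%:C,
          shifted_moment rho 3 = ((S + 2) ^+ 3 + 3 * C * (S + 2) + C3)%:C
        & shifted_moment rho 4 =
            ((S + 3) ^+ 4 + 6 * C * (S + 3) ^+ 2 + 3 * C ^+ 2
             + 4 * C3 * (S + 3) + C4)%:C].
  (* Both sides become polynomials in the raw moments of orders 1 to 4 once the zeroth moment is set
     to 1, and the identities are then purely algebraic. *)
  rewrite !shifted_moment_expand// /S /C /C3 /C4 entropyE// CE C3E C4E.
  rewrite !big_ord_recr !big_ord0 /= M0 /binomial /=.
  by split; congr (_%:C); ring.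
split=> //.
case: moments => m1 m2 m3 m4.
split.
- by have := bound 1 isT; rewrite m1 lecR addrK expr1.
- have := bound 2 isT; rewrite m2 lecR => /le_trans; apply.
  by rewrite le_eqVlt; apply/orP; left; apply/eqP; ring.
- have := bound 3 isT; rewrite m3 lecR => /le_trans; apply.
  by rewrite le_eqVlt; apply/orP; left; apply/eqP; ring.
- have := bound 4 isT; rewrite m4 lecR => /le_trans; apply.
  by rewrite le_eqVlt; apply/orP; left; apply/eqP; ring.
Qed.
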